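(* For every $m\in\mathbb{N}$ we have $$N(2,3,3;2m)=N(1,3,3;m),\qquad t(2,3,3;8m+6)=2t(1,3,3;m),\qquad t(2,3,3;32m+27)=4t(1,3,3;m).$$ Moreover, for every $n\in\mathbb{Z}^+$ with $n\not\equiv 15\pmod{16}$ we have $$t(2,3,3;n)=\begin{cases} 4N(1,3,3;n+1)&\text{if } n\equiv 0,1\pmod 4,\\ 2N(1,3,3;n+1)&\text{if } n\equiv 2\pmod 8,\\ N(1,3,3;n+1)&\text{if } n\equiv 6\pmod 8 \text{ or } n\equiv 27\pmod{32},\\ \frac 85N(1,3,3;n+1)&\text{if } n\equiv 3,7\pmod{16},\\ \frac 43N(1,3,3;n+1)&\text{if } n\equiv 11\pmod{32}.\end{cases}$$
   Context: $\mathbb{Z}^+$ is the set of positive integers and $\mathbb{N}$ the set of nonnegative integers. For $a,b,c\in\mathbb{Z}^+$ and $n\in\mathbb{N}$, $N(a,b,c;n)$ denotes the number of triples $(x,y,z)\in\mathbb{Z}^3$ with $n=ax^2+by^2+cz^2$, and $t(a,b,c;n)$ denotes the number of triples $(x,y,z)\in\mathbb{Z}^3$ with $n=a\frac{x(x+1)}2+b\frac{y(y+1)}2+c\frac{z(z+1)}2$. *)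

(* Defs.v *)
From mathcomp Require Import all_boot all_algebra.
Set Implicit Arguments. Unset Strict Implicit. Unset Printing Implicit Defensive.
Import GRing.Theory Num.Theory.
Local Open Scope ring_scope.

Definition box (B : nat) : seq int := [seq (i%:Z - B%:Z) | i <- iota 0 (2 * B + 1)].

Definition box3 (B : nat) : seq (int * int * int) :=
  flatten [seq [seq (x, y, z) | x <- box B, y <- box B] | z <- box B].

(* N(a,b,c;n) = #{(x,y,z) in Z^3 : n = a x^2 + b y^2 + c z^2}.
   For a,b,c >= 1 every solution satisfies |x|,|y|,|z| <= n, so counting over
   [-n, n]^3 counts all integer solutions. *)
Definition Ncount (a b c n : nat) : nat :=
  size [seq p <- box3 n |
        a%:Z * p.1.1 ^+ 2 + b%:Z * p.1.2 ^+ 2 + c%:Z * p.2 ^+ 2 == n%:Z].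

Definition tri (x : int) : int := ((x * (x + 1)) %/ 2)%Z.

(* t(a,b,c;n) = #{(x,y,z) in Z^3 : n = a T(x) + b T(y) + c T(z)}, T(x) = x(x+1)/2.
   Since T(x) >= 0 and T(x) >= |x| - 1, for a,b,c >= 1 every solution satisfies
   |x|,|y|,|z| <= n+1, so counting over [-(n+1), n+1]^3 counts all solutions. *)
Definition tcount (a b c n : nat) : nat :=
  size [seq p <- box3 n.+1 |
        a%:Z * tri p.1.1 + b%:Z * tri p.1.2 + c%:Z * tri p.2 == n%:Z].

(* Main.v *)
Require Import Defs.
From mathcomp Require Import all_boot all_algebra.
From mathcomp Require Import zify ring.
Import GRing.Theory Num.Theory.
Local Open Scope nat_scope.

(** Put Q(x,y,z) = x^2 + 3y^2 + 3z^2 and let D(k) be the number of solutions of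
    Q = k with x, y of different parity.  Since
    2x^2 + 3(u+v)^2 + 3(u-v)^2 = 2(x^2 + 3u^2 + 3v^2), t(2,3,3;k-1) counts the solutions
    of Q = 4k with x odd.  For q odd, multiplication of x + y sqrt(-3) by
    1 - sqrt(-3) and by its conjugate shows that the representations of 4q by
    X^2 + 3Y^2 with X, Y odd are twice as many as the representations of q by
    x^2 + 3y^2.  Hence t(2,3,3;k-1) = 4 D(k) and D(4k) = 2 D(k), while the
    solutions of Q = 4k with x even are all divisible by 2, so
    N(4k) = 4 D(k) + N(k).  Finally D(k) is compared with N(k) through the parity
    patterns possible modulo 8: N = D, 2D, 4D for k = 1, 2 (mod 4), k = 3 (mod 8)
    and k = 7 (mod 8) respectively. *)

(** * Boxes and bijective counting *)

Lemma mem_box B (x : int) : (x \in box B) = (`|x|%N <= B).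
Proof.
apply/mapP/idP => [[i]|xB]; first by rewrite mem_iota => iB ->; lia.
by exists `|(x + B%:Z)%R|%N; rewrite ?mem_iota; lia.
Qed.

Lemma box3E B :
  box3 B = [seq (p.1, p.2, z) | z <- box B, p <- [seq (x, y) | x <- box B, y <- box B]].
Proof. by rewrite /box3; congr flatten; apply: eq_map => z; rewrite map_allpairs. Qed.

Lemma mem_box3 B x y z :
  ((x, y, z) \in box3 B) = [&& `|x|%N <= B, `|y|%N <= B & `|z|%N <= B].
Proof.
rewrite box3E -!mem_box; apply/allpairsP/and3P => [[[z' [x' y']] /=]|[xB yB zB]].
  by move=> [zB /allpairsP[[a b] /= [? ? [-> ->]]] [-> -> ->]].
by exists (z, (x, y)); split=> //; apply/allpairsP; exists (x, y).
Qed.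

Lemma uniq_box3 B : uniq (box3 B).
Proof.
have uB : uniq (box B) by rewrite map_inj_uniq ?iota_uniq // => i j; lia.
rewrite box3E allpairs_uniq //; first by rewrite allpairs_uniq // => -[? ?] [].
by move=> [z [x y]] [z' [x' y']] _ _ /= [-> -> ->].
Qed.

(** Since both boxes contain all solutions, [f] may be treated as a map on the whole of Z^3, with no
    regard to how it moves the boxes. *)
Lemma count_box3_bij (P P' : pred (int * int * int)) B B' f :
  {subset P <= box3 B} -> {subset P' <= box3 B'} -> injective f ->
  (forall p, P' (f p) = P p) -> (forall q, P' q -> exists p, q = f p) ->
  count P (box3 B) = count P' (box3 B').
Proof.
move=> PB PB' finj fP fsurj; rewrite -!size_filter -(size_map f).
apply: perm_size; apply: uniq_perm.
- by rewrite (map_inj_uniq finj) filter_uniq ?uniq_box3.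
- by rewrite filter_uniq ?uniq_box3.
move=> q; rewrite mem_filter; apply/mapP/andP => [[p]|[Pq _]].
  by rewrite mem_filter => /andP[Pp _] ->; split; last apply: PB'; rewrite ?unfold_in fP.
have [p qE] := fsurj q Pq; exists p => //.
have Pp : P p by rewrite -fP -qE.
by rewrite mem_filter Pp PB.
Qed.

(** * Solutions of x^2 + 3y^2 + 3z^2 = k *)

Definition form133 (p : int * int * int) : int :=
  (p.1.1 ^+ 2 + 3 * p.1.2 ^+ 2 + 3 * p.2 ^+ 2)%R.

Definition odd_int (x : int) : bool := ((x %% 2)%Z == 1)%R.

Definition N133 (k : nat) (P : pred (int * int * int)) : nat :=
  count (fun p => (form133 p == k%:Z)%R && P p) (box3 k).

Lemma abs_le_sqr (x : int) : (`|x|%:Z <= x ^+ 2)%R.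
Proof. rewrite expr2; nia. Qed.

Lemma form133_box k P : {subset (fun p => (form133 p == k%:Z)%R && P p) <= box3 k}.
Proof.
move=> [[x y] z]; rewrite unfold_in mem_box3 /form133 /= => /andP[/eqP E _].
move: (abs_le_sqr x) (abs_le_sqr y) (abs_le_sqr z) E.
by move: (x ^+ 2)%R (y ^+ 2)%R (z ^+ 2)%R => a b c; lia.
Qed.

Lemma N133_bij k k' P P' f : injective f ->
  (forall p, (form133 (f p) == k'%:Z)%R && P' (f p) = ((form133 p == k%:Z)%R && P p)) ->
  (forall q, form133 q = k'%:Z%R -> P' q -> exists p, q = f p) ->
  N133 k P = N133 k' P'.
Proof.
move=> finj fP fsurj; apply: (count_box3_bij _ _ _ _ f) => //; try exact: form133_box.
by move=> q /andP[/eqP]; apply: fsurj.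
Qed.

Lemma eq_N133 k P P' :
  (forall p, form133 p = k%:Z%R -> P p = P' p) -> N133 k P = N133 k P'.
Proof. by move=> PP'; apply: eq_count => p /=; case: eqP => //= /PP'. Qed.

Lemma N133_split k (R P : pred (int * int * int)) :
  N133 k P = N133 k (predI P R) + N133 k (predI P (predC R)).
Proof.
rewrite /N133; elim: (box3 k) => //= p s ->.
by rewrite addnACA; congr addn; case: (_ == _); case: (P p); case: (R p).
Qed.

Lemma N133_swap k (P : pred (int * int * int)) :
  N133 k (fun p => P (p.1.1, p.2, p.1.2)) = N133 k P.
Proof.
apply: (N133_bij _ _ _ _ (fun p => (p.1.1, p.2, p.1.2))).
- by move=> [[x y] z] [[x' y'] z'] [-> -> ->].
- by move=> [[x y] z]; rewrite /form133 /= addrAC.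
- by move=> [[x y] z] _ _; exists (x, z, y).
Qed.

Lemma Ncount133 k : Ncount 1 3 3 k = N133 k predT.
Proof.
rewrite /Ncount /N133 size_filter; apply: eq_count => p.
by rewrite andbT /form133 mul1r.
Qed.

(** * Squares modulo 8 and triangular numbers *)

Lemma sqr_mod8 (x : int) :
  ((x ^+ 2) %% 8)%Z = (if odd_int x then 1 else if (x %% 4)%Z == 0 then 0 else 4)%R.
Proof.
rewrite /odd_int.
have rb : (0 <= (x %% 8)%Z < 8)%R by lia.
move: (divz_eq x 8) rb; move: (x %/ 8)%Z (x %% 8)%Z => q r xE rb.
have -> : (x ^+ 2)%R = ((8 * q ^+ 2 + 2 * q * r) * 8 + r ^+ 2)%R by rewrite {1}xE; ring.
rewrite modzMDl.
have : (r = 0 \/ r = 1 \/ r = 2 \/ r = 3 \/ r = 4 \/ r = 5 \/ r = 6 \/ r = 7)%R by lia.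
by clear rb; do 7?[case]; move=> rE; subst r; rewrite expr2 xE; do 2?case: ifP => ?; lia.
Qed.

Lemma triE (x : int) : (2 * tri x = x ^+ 2 + x)%R.
Proof.
rewrite /tri mulrDr mulr1 -expr2; have := sqr_mod8 x; rewrite /odd_int.
by do 2?case: ifP; move: (x ^+ 2)%R => a; lia.
Qed.

Lemma tri_box a b c n : 0 < a -> 0 < b -> 0 < c ->
  {subset (fun p => a%:Z * tri p.1.1 + b%:Z * tri p.1.2 + c%:Z * tri p.2 == n%:Z)%R
   <= box3 n.+1}.
Proof.
move=> a0 b0 c0 [[x y] z]; rewrite unfold_in mem_box3 /= => /eqP E.
have triB (t : int) : (0 <= tri t)%R /\ (`|t|%:Z <= tri t + 1)%R.
  (* For t < 0 the second bound amounts to (t + 1)(t + 2) >= 0, that is |t + 1| <= (t + 1)^2. *)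
  have := abs_le_sqr (t + 1)%R; rewrite sqrrD expr1n mulr1.
  by have := triE t; have := abs_le_sqr t; move: (t ^+ 2)%R => s; lia.
have [+ +] := triB x; have [+ +] := triB y; have [+ +] := triB z.
move: (tri x) (tri y) (tri z) E => u v w E ? ? ? ? ? ?.
have : (u <= a%:Z * u)%R by nia.
have : (v <= b%:Z * v)%R by nia.
have : (w <= c%:Z * w)%R by nia.
move: E; move: (a%:Z * u)%R (b%:Z * v)%R (c%:Z * w)%R; lia.
Qed.

Lemma Ncount233 m : Ncount 2 3 3 (2 * m) = Ncount 1 3 3 m.
Proof.
rewrite Ncount133 /Ncount size_filter; apply/esym.
apply: (count_box3_bij _ _ _ _ (fun p => (p.1.1, p.1.2 + p.2, p.1.2 - p.2)%R)).
- exact: form133_box.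
- move=> [[x y] z]; rewrite unfold_in mem_box3 /= => /eqP.
  move: (abs_le_sqr x) (abs_le_sqr y) (abs_le_sqr z).
  by move: (x ^+ 2)%R (y ^+ 2)%R (z ^+ 2)%R => a b c; lia.
- by move=> [[x y] z] [[x' y'] z'] [-> ? ?]; congr (_, _, _); lia.
- move=> [[x y] z]; rewrite andbT /form133 /=.
  have -> : (2 * x ^+ 2 + 3 * (y + z) ^+ 2 + 3 * (y - z) ^+ 2
    = 2 * (x ^+ 2 + 3 * y ^+ 2 + 3 * z ^+ 2))%R by ring.
  by move: (_ + _)%R => a; lia.
- move=> [[x y] z] /= /eqP E; exists (x, (y + z) %/ 2, (y - z) %/ 2)%Z.
  (* As 2x^2 + 3y^2 + 3z^2 is even, y and z have the same parity, so their half-sum and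
     half-difference are integers. *)
  have : ((y + z) %% 2)%Z = 0%R.
    move: (sqr_mod8 x) (sqr_mod8 y) (sqr_mod8 z) E; rewrite /odd_int.
    by move: (x ^+ 2)%R (y ^+ 2)%R (z ^+ 2)%R => a b c; do 6?case: ifP; lia.
  by move=> ?; congr (_, _, _) => /=; lia.
Qed.

(** * Parity patterns and the translation of [tcount] *)

Definition first_odd (p : int * int * int) := odd_int p.1.1.
Definition all_odd (p : int * int * int) := [&& odd_int p.1.1, odd_int p.1.2 & odd_int p.2].
Definition mixed (p : int * int * int) := odd_int p.1.1 != odd_int p.1.2.
Definition odd_odd_even (p : int * int * int) :=
  [&& odd_int p.1.1, odd_int p.1.2 & ~~ odd_int p.2].
Definition even_odd_even (p : int * int * int) :=
  [&& ~~ odd_int p.1.1, odd_int p.1.2 & ~~ odd_int p.2].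

(** Squares become opaque atoms known only modulo 8, which turns every parity claim into linear
    arithmetic. *)
Ltac parity :=
  let x := fresh "x" in let y := fresh "y" in let z := fresh "z" in
  move=> [[x y] z]; rewrite /form133 /first_odd /all_odd /mixed /odd_odd_even /even_odd_even /=;
  move: (sqr_mod8 x) (sqr_mod8 y) (sqr_mod8 z); rewrite /odd_int;
  move: (x ^+ 2)%R (y ^+ 2)%R (z ^+ 2)%R => ? ? ?; do 6?case: ifP; lia.

(** Completing squares gives 8(n + 1) = 2(2x + 1)^2 + 3(2y + 1)^2 + 3(2z + 1)^2. Writing 2y + 1 = u
    + v and 2z + 1 = u - v and halving gives 4(n + 1) = (2x + 1)^2 + 3u^2 + 3v^2. *)
Lemma tcount233 n : tcount 2 3 3 n = N133 (4 * n.+1) first_odd.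
Proof.
rewrite /tcount size_filter.
apply: (count_box3_bij _ _ _ _ (fun p => (2 * p.1.1 + 1, p.1.2 + p.2 + 1, p.1.2 - p.2)%R)).
- exact: tri_box.
- exact: form133_box.
- by move=> [[x y] z] [[x' y'] z'] [? ? ?]; congr (_, _, _); lia.
- move=> [[x y] z]; rewrite /form133 /first_odd /odd_int /=.
  have -> : ((2 * x + 1) ^+ 2 + 3 * (y + z + 1) ^+ 2 + 3 * (y - z) ^+ 2
    = 4 * (x ^+ 2 + x) + 6 * (y ^+ 2 + y) + 6 * (z ^+ 2 + z) + 4)%R by ring.
  rewrite -!triE; move: (tri x) (tri y) (tri z) => a b c; lia.
- move=> [[x y] z] /andP[/eqP E xo].
  exists ((x - 1) %/ 2, (y + z - 1) %/ 2, (y - z - 1) %/ 2)%Z.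
  move: E xo; rewrite /form133 /first_odd /= => E xo.
  (* Modulo 4, an odd x forces exactly one of y, z to be odd. *)
  have : odd_int (y + z)%R.
    move: (sqr_mod8 x) (sqr_mod8 y) (sqr_mod8 z) E xo; rewrite /odd_int.
    by move: (x ^+ 2)%R (y ^+ 2)%R (z ^+ 2)%R => a b c; do 6?case: ifP; lia.
  by move: xo; rewrite /odd_int => *; congr (_, _, _); lia.
Qed.

Lemma tcount133 m : tcount 1 3 3 m = N133 (8 * m + 7) all_odd.
Proof.
rewrite /tcount size_filter.
apply: (count_box3_bij _ _ _ _ (fun p => (2 * p.1.1 + 1, 2 * p.1.2 + 1, 2 * p.2 + 1)%R)).
- exact: tri_box.
- exact: form133_box.
- by move=> [[x y] z] [[x' y'] z'] [? ? ?]; congr (_, _, _); lia.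
- move=> [[x y] z]; rewrite /form133 /all_odd /odd_int /=.
  have -> : ((2 * x + 1) ^+ 2 + 3 * (2 * y + 1) ^+ 2 + 3 * (2 * z + 1) ^+ 2
    = 4 * (x ^+ 2 + x) + 12 * (y ^+ 2 + y) + 12 * (z ^+ 2 + z) + 7)%R by ring.
  rewrite -!triE; move: (tri x) (tri y) (tri z) => a b c; lia.
- move=> [[x y] z] /andP[_]; rewrite /all_odd /odd_int /= => ?.
  by exists ((x - 1) %/ 2, (y - 1) %/ 2, (z - 1) %/ 2)%Z; congr (_, _, _) => /=; lia.
Qed.

Lemma N133_quadruple k : N133 (4 * k) predT = N133 (4 * k) first_odd + N133 k predT.
Proof.
rewrite (N133_split _ first_odd); congr addn.
apply/esym/(N133_bij _ _ _ _ (fun p => (2 * p.1.1, 2 * p.1.2, 2 * p.2)%R)).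
- by move=> [[x y] z] [[x' y'] z'] [? ? ?]; congr (_, _, _); lia.
- move=> [[x y] z]; rewrite /form133 /first_odd /odd_int /=.
  have -> : ((2 * x) ^+ 2 + 3 * (2 * y) ^+ 2 + 3 * (2 * z) ^+ 2
    = 4 * (x ^+ 2 + 3 * y ^+ 2 + 3 * z ^+ 2))%R by ring.
  move: (_ + _)%R => a; lia.
- move=> [[x y] z] /= E xe; exists (x %/ 2, y %/ 2, z %/ 2)%Z => /=.
  (* With x even, 4 divides y^2 + z^2, so y and z are even too. *)
  have : ~~ odd_int x /\ ~~ odd_int y /\ ~~ odd_int z.
    move: (sqr_mod8 x) (sqr_mod8 y) (sqr_mod8 z) E xe; rewrite /form133 /first_odd /odd_int /=.
    by move: (x ^+ 2)%R (y ^+ 2)%R (z ^+ 2)%R => a b c; do 6?case: ifP; lia.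
  by rewrite /odd_int => *; congr (_, _, _); lia.
Qed.

(** Exactly one of y, z is odd, and swapping them exchanges the two cases. *)
Lemma N133_first_odd k : N133 (4 * k) first_odd = 2 * N133 (4 * k) odd_odd_even.
Proof.
rewrite (N133_split _ (fun p => odd_int p.1.2)) mul2n -addnn; congr addn; last first.
  by rewrite -N133_swap; apply: eq_N133; parity.
by apply: eq_N133; parity.
Qed.

(** * Multiplication by 1 - sqrt(-3) *)

Lemma N133_flip k (P : pred (int * int * int)) :
  N133 k (fun p => P (p.1.1, - p.1.2, p.2)%R) = N133 k P.
Proof.
apply: (N133_bij _ _ _ _ (fun p => (p.1.1, - p.1.2, p.2)%R)).
- by move=> [[x y] z] [[x' y'] z'] [? ? ?]; congr (_, _, _); lia.
- by move=> [[x y] z]; rewrite /form133 /= sqrrN.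
- by move=> [[x y] z] _ _; exists (x, - y, z)%R; rewrite /= opprK.
Qed.

(** This is [form133] at (x + 3y, y - x, z). The first two entries are odd exactly when (x, y, z) is
    [mixed]. *)
Definition form_4_12_3 (p : int * int * int) : int :=
  (4 * (p.1.1 ^+ 2 + 3 * p.1.2 ^+ 2) + 3 * p.2 ^+ 2)%R.

Definition Nmixed (k : nat) (P : pred int) : nat :=
  count (fun p => [&& form_4_12_3 p == k%:Z, mixed p & P p.2]%R) (box3 k).

Lemma form_4_12_3_box k P :
  {subset (fun p => [&& form_4_12_3 p == k%:Z, mixed p & P p.2]%R) <= box3 k}.
Proof.
move=> [[x y] z]; rewrite unfold_in mem_box3 /form_4_12_3 /= => /andP[/eqP E _].
move: (abs_le_sqr x) (abs_le_sqr y) (abs_le_sqr z) E.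
by move: (x ^+ 2)%R (y ^+ 2)%R (z ^+ 2)%R => a b c; lia.
Qed.

(* X + Y is divisible by 4 for exactly one sign of Y, and then
   (X, Y) = (x + 3y, y - x), i.e. X + Y sqrt(-3) = (1 - sqrt(-3)) (x + y sqrt(-3)). *)
Lemma N133_odd_odd k (P : pred int) :
  N133 k (fun p => [&& odd_int p.1.1, odd_int p.1.2 & P p.2]) = 2 * Nmixed k P.
Proof.
rewrite (N133_split _ (fun p => (p.1.1 + p.1.2) %% 4 == 0)%Z%R).
set A := N133 _ _; set B := N133 _ _.
have -> : B = A.
  rewrite /A -N133_flip; apply: eq_N133 => -[[x y] z] _ /=; rewrite /odd_int.
  by case: (P z); lia.
suff -> : A = Nmixed k P by rewrite mul2n addnn.
apply/esym/(count_box3_bij _ _ _ _ (fun p => (p.1.1 + 3 * p.1.2, p.1.2 - p.1.1, p.2)%R)).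
- exact: form_4_12_3_box.
- exact: form133_box.
- by move=> [[x y] z] [[x' y'] z'] [? ? ?]; congr (_, _, _); lia.
- move=> [[x y] z]; rewrite /form133 /form_4_12_3 /mixed /odd_int /=.
  have -> : ((x + 3 * y) ^+ 2 + 3 * (y - x) ^+ 2 = 4 * (x ^+ 2 + 3 * y ^+ 2))%R by ring.
  by case: (_ == _); case: (P z); rewrite ?andbF //=; lia.
- move=> [[x y] z] /andP[_]; rewrite /odd_int /= => H.
  by exists ((x - 3 * y) %/ 4, (x + y) %/ 4, z)%Z; congr (_, _, _) => /=; lia.
Qed.

Lemma Nmixed_even k : Nmixed (4 * k) (predC odd_int) = N133 k mixed.
Proof.
apply/esym/(count_box3_bij _ _ _ _ (fun p => (p.1.1, p.1.2, 2 * p.2)%R)).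
- exact: form133_box.
- exact: form_4_12_3_box.
- by move=> [[x y] z] [[x' y'] z'] [? ? ?]; congr (_, _, _); lia.
- move=> [[x y] z]; rewrite /form133 /form_4_12_3 /mixed /odd_int /=.
  have -> : (4 * (x ^+ 2 + 3 * y ^+ 2) + 3 * (2 * z) ^+ 2
    = 4 * (x ^+ 2 + 3 * y ^+ 2 + 3 * z ^+ 2))%R by ring.
  by move: (_ + _)%R => a; lia.
- move=> [[x y] z] /and3P[_ _]; rewrite /odd_int /= => ?.
  by exists (x, y, z %/ 2)%Z; congr (_, _, _) => /=; lia.
Qed.

(** The factor 4 is absorbed as (2x)^2 + 3(2y)^2. Being [mixed] is then automatic: an odd z leaves
    4(x^2 + 3y^2) congruent to 4 modulo 8, so x^2 + 3y^2 is odd. *)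
Lemma Nmixed_odd k : k %% 8 = 7 -> Nmixed k odd_int = N133 k even_odd_even.
Proof.
move=> k7; rewrite -N133_swap.
apply: (count_box3_bij _ _ _ _ (fun p => (2 * p.1.1, 2 * p.1.2, p.2)%R)).
- exact: form_4_12_3_box.
- exact: form133_box.
- by move=> [[x y] z] [[x' y'] z'] [? ? ?]; congr (_, _, _); lia.
- move=> [[x y] z]; rewrite /form133 /form_4_12_3 /mixed /even_odd_even /=.
  have -> : ((2 * x) ^+ 2 + 3 * (2 * y) ^+ 2 = 4 * (x ^+ 2 + 3 * y ^+ 2))%R by ring.
  move: (sqr_mod8 x) (sqr_mod8 y) (sqr_mod8 z); rewrite /odd_int.
  by move: (x ^+ 2)%R (y ^+ 2)%R (z ^+ 2)%R => a b c; do 6?case: ifP; lia.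
- move=> [[x y] z] /andP[_]; rewrite /even_odd_even /odd_int /= => ?.
  by exists (x %/ 2, y %/ 2, z)%Z; congr (_, _, _) => /=; lia.
Qed.

(** * Comparison of all solutions with the [mixed] ones *)

Lemma N133_first_odd_mixed k : N133 (4 * k) first_odd = 4 * N133 k mixed.
Proof. by rewrite N133_first_odd (N133_odd_odd _ (predC odd_int)) Nmixed_even mulnA. Qed.

(** If x and y have the same parity, then 4 divides x^2 + 3y^2, which leaves 3z^2, congruent to 0 or
    3 modulo 4. *)
Lemma N133_mixed_12mod4 k : (k %% 4 == 1) || (k %% 4 == 2) ->
  N133 k predT = N133 k mixed.
Proof. by move=> k12; apply: eq_N133; parity. Qed.

(** Here x is even and exactly one of y, z is odd; [mixed] selects the solutions with y odd. *)
Lemma N133_mixed_3mod8 k : k %% 8 = 3 -> N133 k predT = 2 * N133 k mixed.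
Proof.
move=> k3; rewrite (N133_split _ mixed) mul2n -addnn; congr addn.
by rewrite -N133_swap; apply: eq_N133; parity.
Qed.

Lemma N133_even_odd_even k : k %% 8 = 7 -> N133 k even_odd_even = N133 k mixed.
Proof. by move=> k7; apply: eq_N133; parity. Qed.

Lemma N133_all_odd k : k %% 8 = 7 -> N133 k all_odd = 2 * N133 k mixed.
Proof. by move=> k7; rewrite (N133_odd_odd _ odd_int) Nmixed_odd // N133_even_odd_even. Qed.

(** Three patterns occur: all odd, only y odd, only z odd. They contribute 2, 1 and 1 times the
    [mixed] count. *)
Lemma N133_mixed_7mod8 k : k %% 8 = 7 -> N133 k predT = 4 * N133 k mixed.
Proof.
move=> k7; rewrite (N133_split _ all_odd) (N133_split _ mixed (predI _ (predC _))).
have -> : N133 k (predI predT all_odd) = 2 * N133 k mixed by exact: N133_all_odd.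
have -> : N133 k (predI (predI predT (predC all_odd)) mixed) = N133 k mixed.
  by apply: eq_N133; parity.
have -> : N133 k (predI (predI predT (predC all_odd)) (predC mixed)) = N133 k mixed.
  by rewrite -[RHS]N133_swap; apply: eq_N133; parity.
lia.
Qed.

(** Modulo 4, a [mixed] solution for 4k has x and z odd and y even, so after a swap [N133_odd_odd]
    applies. *)
Lemma N133_mixed_quadruple k : N133 (4 * k) mixed = 2 * N133 k mixed.
Proof.
rewrite -(Nmixed_even k) -(N133_odd_odd _ (predC odd_int)) -N133_swap.
by apply: eq_N133; parity.
Qed.

Lemma N133_predT_quadruple k : N133 (4 * k) predT = 4 * N133 k mixed + N133 k predT.
Proof. by rewrite N133_quadruple N133_first_odd_mixed. Qed.

Theorem theorem2p1 :
  (forall m : nat,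
      Ncount 2 3 3 (2 * m) = Ncount 1 3 3 m
   /\ tcount 2 3 3 (8 * m + 6) = 2 * tcount 1 3 3 m
   /\ tcount 2 3 3 (32 * m + 27) = 4 * tcount 1 3 3 m)
  /\
  (forall n : nat, 0 < n -> n %% 16 != 15 ->
      ((n %% 4 == 0) || (n %% 4 == 1) ->
         tcount 2 3 3 n = 4 * Ncount 1 3 3 n.+1)
   /\ (n %% 8 == 2 -> tcount 2 3 3 n = 2 * Ncount 1 3 3 n.+1)
   /\ ((n %% 8 == 6) || (n %% 32 == 27) -> tcount 2 3 3 n = Ncount 1 3 3 n.+1)
   /\ ((n %% 16 == 3) || (n %% 16 == 7) ->
         ((tcount 2 3 3 n)%:R = (8%:R / 5%:R) * (Ncount 1 3 3 n.+1)%:R :> rat)%R)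
   /\ (n %% 32 == 11 ->
         ((tcount 2 3 3 n)%:R = (4%:R / 3%:R) * (Ncount 1 3 3 n.+1)%:R :> rat)%R)).
Proof.
have tE n : tcount 2 3 3 n = 4 * N133 n.+1 mixed.
  by rewrite tcount233 N133_first_odd_mixed.
split=> [m|n _ _].
  rewrite Ncount233 !tE tcount133 N133_all_odd; last by lia.
  have -> : (8 * m + 6).+1 = 8 * m + 7 by lia.
  have -> : (32 * m + 27).+1 = 4 * (8 * m + 7) by lia.
  by rewrite N133_mixed_quadruple; lia.
have quad : n %% 4 = 3 -> exists k, n.+1 = 4 * k.
  by exists (n.+1 %/ 4); lia.
rewrite !Ncount133 tE; do 4?split.
- by move=> n01; rewrite (N133_mixed_12mod4 n.+1) //; lia.
- by move=> n2; rewrite (N133_mixed_3mod8 n.+1); lia.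
- case/orP=> n67; first by rewrite (N133_mixed_7mod8 n.+1); lia.
  (* Here k is 7 modulo 8; with D the [mixed] count of k, t = 8D and N = 4D + 4D. *)
  have [|k kE] := quad; first by lia.
  rewrite kE N133_mixed_quadruple N133_predT_quadruple (N133_mixed_7mod8 k); lia.
(* Here k is 1 or 2 modulo 4, so t = 8D and N = 4D + D. *)
- move=> n37; have [|k kE] := quad; first by lia.
  rewrite kE N133_mixed_quadruple N133_predT_quadruple (N133_mixed_12mod4 k); last by lia.
  by rewrite !(natrM, natrD); field.
(* Here k is 3 modulo 8, so t = 8D and N = 4D + 2D. *)
- move=> n11; have [|k kE] := quad; first by lia.
  rewrite kE N133_mixed_quadruple N133_predT_quadruple (N133_mixed_3mod8 k); last by lia.
  by rewrite !(natrM, natrD); field.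
Qed.
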